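(* Let $K$ be a field, $S=K[x_1,\ldots,x_n]$, and let $J\subsetneq I\subset S$ be monomial ideals. Let $\overline{I/J}$ be the canonical form of $I/J$. Then $$\operatorname{sdepth}_S (I/J)=\operatorname{sdepth}_S\big(\overline{I/J}\big).$$
   Context: Canonical form. For a monomial ideal $L\subset S$, $G(L)$ denotes its minimal system of monomial generators. The power $x_j^r$ enters in a monomial $u$ if $x_j^r\mid u$ but $x_j^{r+1}\nmid u$. Let $J\subsetneq I\subset S$ be monomial ideals. The factor $I/J$ is of type $(k_1,\ldots,k_s)$ with respect to $x_j$ if $1\le k_1<\cdots<k_s$ and $x_j^{k_1},\ldots,x_j^{k_s}$ are exactly the powers of $x_j$ with positive exponent which enter in some monomial of $G(I)\cup G(J)$. The canonical form of $I/J$ with respect to $x_j$ is the factor $I'/J'$, where $I'$ (resp. $J'$) is the ideal generated by the monomials obtained from those of $G(I)$ (resp. $G(J)$) by replacing $x_j^{k_i}$ by $x_j^{i}$ whenever $x_j^{k_i}$ enters in the generator; generators not divisible by $x_j$ are left unchanged. The canonical form $\overline{I/J}$ of $I/J$ is obtained by applying this procedure successively with respect to all variables $x_1,\ldots,x_n$. Stanley depth. Factors of monomial ideals are considered with their natural $\mathbb{Z}^n$-grading. A Stanley decomposition of a graded $S$-module $M$ is a finite family $\mathcal D=(S_i,u_i)_{i\in\Lambda}$, where each $u_i\in M$ is homogeneous and each $S_i$ is a graded $K$-algebra retract of $S$ (for the $\mathbb{Z}^n$-grading, $S_i=K[Z_i]$ for a subset $Z_i\subseteq\{x_1,\ldots,x_n\}$),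 such that $S_i\cap\operatorname{Ann}(u_i)=0$ and $M=\bigoplus_{i\in\Lambda}S_iu_i$ as a graded $K$-vector space. The Stanley depth $\operatorname{sdepth}(\mathcal D)$ of $\mathcal D$ is the depth of the $S$-module $\bigoplus_{i\in\Lambda} S_iu_i$, where each $S_iu_i\cong S_i$ is an $S$-module via the retraction $S\to S_i$; thus $\operatorname{sdepth}(\mathcal D)=\min_i |Z_i|$. The Stanley depth $\operatorname{sdepth}_S(M)$ is the maximum of $\operatorname{sdepth}(\mathcal D)$ over all Stanley decompositions $\mathcal D$ of $M$. *)

(* Defs.v *)
From HB Require Import structures.
From mathcomp Require Import all_boot all_order all_algebra.
From mathcomp Require Import generic_quotient ring_quotient.
From mathcomp Require Import boolp classical_sets.
From mathcomp Require Import mpoly.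

Set Implicit Arguments.
Unset Strict Implicit.
Unset Printing Implicit Defensive.

Import Order.TTheory GRing.Theory.
Local Open Scope ring_scope.
Local Open Scope quotient_scope.
Local Open Scope classical_set_scope.

Section QuotientModule.
Variables (R : nzRingType) (V : lmodType R) (W : submodClosed V).

Definition submod_pred : {pred V} := W.

HB.instance Definition _ :=
  GRing.isZmodClosed.Build V submod_pred (GRing.submod_closedB (submodClosedP W)).

Definition lmod_quot := Quotient.quot submod_pred.

HB.instance Definition _ := GRing.Zmodule.on lmod_quot.
HB.instance Definition _ := EqQuotient.on lmod_quot.

Definition lmod_quot_scale (a : R) (x : lmod_quot) : lmod_quot :=
  \pi_lmod_quot (a *: repr x).

Lemma lmod_quot_scale_pi a v :
  lmod_quot_scale a (\pi_lmod_quot v) = \pi_lmod_quot (a *: v).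
Proof.
apply/eqquotP; rewrite /= Quotient.equivE -scalerBr /submod_pred rpredZ //.
have : repr (\pi_lmod_quot v) - v \in submod_pred.
  by rewrite Quotient.idealrBE reprK.
by [].
Qed.

Let pi_add (x y : V) :
  \pi_lmod_quot x + \pi_lmod_quot y = \pi_lmod_quot (x + y).
Proof. by rewrite (@Quotient.pi_add V submod_pred). Qed.

Let scaleA a b x :
  lmod_quot_scale a (lmod_quot_scale b x) = lmod_quot_scale (a * b) x.
Proof.
elim/quotW: x => v; rewrite (lmod_quot_scale_pi b v).
by rewrite (lmod_quot_scale_pi a) (lmod_quot_scale_pi (a * b) v) scalerA.
Qed.

Let scale1 : left_id 1 lmod_quot_scale.
Proof.
by move=> x; elim/quotW: x => v; rewrite (lmod_quot_scale_pi 1 v) scale1r.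
Qed.

Let scaleDr : right_distributive lmod_quot_scale +%R.
Proof.
move=> a; elim/quotW=> v; elim/quotW=> w.
by rewrite pi_add (lmod_quot_scale_pi a (v + w)) scalerDr -pi_add
  -(lmod_quot_scale_pi a v) -(lmod_quot_scale_pi a w).
Qed.

Let scaleDl x : {morph lmod_quot_scale^~ x : a b / a + b}.
Proof.
move=> a b; elim/quotW: x => v.
by rewrite (lmod_quot_scale_pi _ v) scalerDl -pi_add
  -(lmod_quot_scale_pi a v) -(lmod_quot_scale_pi b v).
Qed.

HB.instance Definition _ := GRing.Zmodule_isLmodule.Build R lmod_quot
  scaleA scale1 scaleDr scaleDl.

End QuotientModule.

Section MonomialIdeals.
Variables (K : fieldType) (n : nat).
Local Notation S := {mpoly K[n]}.
Implicit Types (A B : set 'X_{1..n}) (p q : S) (m : 'X_{1..n}).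

Definition is_ideal (L : set S) : Prop :=
  GRing.submod_closed (mem L : {pred S^o}).

Definition ideal_gen (G : set S) : set S := smallest is_ideal G.

Definition monomial_gen A : set S := ideal_gen [set 'X_[m] | m in A].

Definition is_monomial_ideal (L : set S) : Prop :=
  exists A, L = monomial_gen A.

Record monIdeal := MonIdeal {
  monIdeal_set :> set S;
  monIdealP : is_monomial_ideal monIdeal_set }.

Definition monIdeal_gen A : monIdeal :=
  MonIdeal (ex_intro _ A (erefl (monomial_gen A))).

(* G(L): the monomials of L that are minimal for divisibility; see
   [monomial_gen_mingens] and [mingens_minimal]. *)
Definition mingens (L : set S) : set 'X_{1..n} :=
  [set m | L 'X_[m] /\ forall m', L 'X_[m'] -> (m' <= m)%MM -> m' = m].

Lemma is_idealP (L : set S) :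
  is_ideal L <-> [/\ L 0, forall p q, L p -> L q -> L (p + q)
                  & forall p q, L q -> L (p * q)].
Proof.
split=> [[L0 Ll]|[L0 LD LM]].
  have LM p q : L q -> L (p * q).
    move=> Lq; have := Ll p q 0; rewrite !inE addr0; apply=> //.
    by rewrite inE in L0.
  rewrite inE in L0; split=> // p q Lp Lq.
  by have := Ll 1 p q; rewrite !inE scale1r; apply.
split; first by rewrite inE.
by move=> a p q; rewrite !inE => Lp Lq; apply: LD => //; apply: LM.
Qed.

Lemma ideal_gen_ideal G : is_ideal (ideal_gen G).
Proof.
apply/is_idealP; split=> [L [/is_idealP[]]|p q Lp Lq L LG|p q Lq L LG] //.
  by case: (LG) => /is_idealP[_ LD _] _; apply: LD; [apply: Lp|apply: Lq].
by case: (LG) => /is_idealP[_ _ LM] _; apply: LM; apply: Lq.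
Qed.

Lemma monIdeal_ideal (L : monIdeal) : is_ideal L.
Proof. by have [A ->] := monIdealP L; apply: ideal_gen_ideal. Qed.

Lemma monomial_genP A p :
  monomial_gen A p <->
  (forall m, m \in msupp p -> exists2 a, A a & (a <= m)%MM).
Proof.
split.
  move=> Ap; apply: (Ap [set p | forall m, m \in msupp p ->
                           exists2 a, A a & (a <= m)%MM]).
  split; last first.
    move=> _ [a Aa <-] m; rewrite msuppX mem_seq1 => /eqP->; exists a => //.
    exact: lepm_refl.
  apply/is_idealP; split=> /=.
  - by move=> m; rewrite msupp0.
  - by move=> q r Aq Ar m /msuppD_le; rewrite mem_cat => /orP[/Aq|/Ar].
  move=> q r Ar m /msuppM_le/allpairsP[[m1 m2] /= [_ /Ar[a Aa le_a] ->]].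
  by exists a => //; apply: (lepm_trans le_a); apply: lem_addl.
have /is_idealP[L0 LD LM] := ideal_gen_ideal [set 'X_[K, m] | m in A].
move=> Ap; rewrite [p]mpolyE big_seq; apply: (big_ind (monomial_gen A)) => //.
move=> m /Ap[a Aa le_a]; rewrite -mul_mpolyC; apply: (LM).
rewrite -(submK le_a) mpolyXD; apply: LM.
by move=> L [_ AL]; apply: AL; exists a.
Qed.

Lemma monomial_genX A m :
  monomial_gen A 'X_[m] <-> exists2 a, A a & (a <= m)%MM.
Proof.
rewrite monomial_genP msuppX; split=> [|am k].
  by apply; rewrite mem_seq1.
by rewrite mem_seq1 => /eqP->.
Qed.

Lemma monomial_gen_mingens (L : monIdeal) :
  monomial_gen (mingens L) = L.
Proof.
have min m : (L : set S) 'X_[m] -> exists2 g, mingens L g & (g <= m)%MM.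
  have [d] := ubnP (mdeg m); elim: d m => // d IHd m le_md Lm.
  have [gm|] := pselect (mingens L m); first by exists m => //; apply: lepm_refl.
  move=> /not_andP[//|] /existsNP[m' /not_implyP[Lm' /not_implyP[le_m' ne_m']]].
  have [|g Lg le_g] := IHd m' _ Lm'; last first.
    by exists g => //; apply: lepm_trans le_g le_m'.
  rewrite (leq_trans _ (_ : mdeg m <= d)%N) // -(submK le_m') mdegD.
  rewrite -[ltnLHS]add0n ltn_add2r lt0n mdeg_eq0; apply/eqP => mm'.
  by apply: ne_m'; rewrite -(submK le_m') mm' add0m.
case: L min => L /= [A LA] min; rewrite {2}LA; apply/seteqP; split=> p.
  rewrite !monomial_genP => Lp m /Lp[g [Lg _] le_g]; move: Lg.
  rewrite LA => /monomial_genX[a Aa le_a].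
  by exists a => //; apply: lepm_trans le_a le_g.
rewrite !monomial_genP => Ap m /Ap[a Aa le_a].
have [|g Lg le_g] := min a; last by exists g => //; apply: lepm_trans le_g le_a.
by rewrite LA; apply/monomial_genX; exists a => //; apply: lepm_refl.
Qed.

Lemma mingens_minimal A : mingens (monomial_gen A) `<=` A.
Proof.
move=> m [/monomial_genX[a Aa le_a] m_min].
rewrite -(m_min a) //; apply/monomial_genX.
by exists a => //; apply: lepm_refl.
Qed.

End MonomialIdeals.

Section Factor.
Variables (K : fieldType) (n : nat).
Local Notation S := {mpoly K[n]}.
Implicit Types I J : monIdeal K n.

Definition monIdeal_pred I : {pred S^o} := fun p => p \in (I : set S).

HB.instance Definition _ I := GRing.isSubmodClosed.Build S S^o
  (monIdeal_pred I) (GRing.submod_closed_semi (monIdeal_ideal I)).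

Definition ideal_mod I := {p : S^o | monIdeal_pred I p}.

HB.instance Definition _ I := SubChoice.on (ideal_mod I).
HB.instance Definition _ I :=
  [SubChoice_isSubLmodule of (ideal_mod I) by <:].

Definition sub_ideal I J : {pred ideal_mod I} :=
  fun p => monIdeal_pred J (\val p).
Arguments sub_ideal : clear implicits.

Lemma sub_ideal_submod I J : GRing.submod_closed (sub_ideal I J).
Proof.
have [J0 Jl] := monIdeal_ideal J.
by split=> [|a p q]; rewrite !unfold_in /sub_ideal ?linear0 ?linearP //; apply: Jl.
Qed.

HB.instance Definition _ I J := GRing.isSubmodClosed.Build S (ideal_mod I)
  (sub_ideal I J) (GRing.submod_closed_semi (sub_ideal_submod I J)).

(* The S-module I/J; for J not contained in I this is I/(I :&: J). *)
Definition factor I J := lmod_quot (sub_ideal I J).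

HB.instance Definition _ I J := GRing.Lmodule.on (factor I J).
HB.instance Definition _ I J := EqQuotient.on (factor I J).

(* The component of degree a of the Z^n-grading of I/J *)
Definition factor_degree I J (a : {ffun 'I_n -> int}) : set (factor I J) :=
  [set \pi_(factor I J) p | p in [set p : ideal_mod I |
     forall m, m \in msupp (\val p : S) -> forall i, (m i)%:Z = a i]].

Lemma factor_pi_eq I J (p q : ideal_mod I) :
  \pi_(factor I J) p = \pi_(factor I J) q <->
  (J : set S) (\val p - \val q).
Proof.
have -> : (\pi_(factor I J) p = \pi_(factor I J) q) <->
          Quotient.equiv (submod_pred (sub_ideal I J)) p q.
  by split=> [/eqquotP|pq]; last apply/eqquotP.
have -> : Quotient.equiv (submod_pred (sub_ideal I J)) p q =
          ((\val p - \val q : S) \in (J : set S)) by rewrite -raddfB.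
by rewrite inE.
Qed.

Lemma factor_pi_scale I J (f : S) (p : ideal_mod I) :
  f *: (\pi_(factor I J) p) = \pi_(factor I J) (f *: p).
Proof. exact: lmod_quot_scale_pi. Qed.

End Factor.

Arguments sub_ideal {K n} I J.
Arguments factor {K n} I J.
Arguments factor_degree {K n} I J a.

Section StanleyDepth.
Variables (K : fieldType) (n : nat).
Local Notation S := {mpoly K[n]}.

(* The subring K[Z]; these are the Z^n-graded K-algebra retracts of S. *)
Definition retract (Z : {set 'I_n}) : set S :=
  [set f | forall m, m \in msupp f -> forall j, m j != 0%N -> j \in Z].

(* [deg a] is the homogeneous component of degree a of M *)
Variables (M : lmodType S) (deg : {ffun 'I_n -> int} -> set M).

Record stanley_family := StanleyFamily {
  sf_card : nat;
  sf_vars : 'I_sf_card -> {set 'I_n};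
  sf_elem : 'I_sf_card -> M }.
Implicit Type D : stanley_family.

Definition stanley_space D (i : 'I_(sf_card D)) : set M :=
  [set f *: sf_elem i | f in retract (sf_vars i)].
Arguments stanley_space : clear implicits.

Definition is_stanley_decomposition D : Prop :=
  [/\ forall i : 'I_(sf_card D), exists a, deg a (sf_elem i),
      forall (i : 'I_(sf_card D)) f,
        retract (sf_vars i) f -> f *: sf_elem i = 0 -> f = 0
    & forall v : M, exists! w : {ffun 'I_(sf_card D) -> M},
        (forall i, stanley_space D i (w i)) /\ v = \sum_i w i].

(* The depth of the S-module \bigoplus_i K[Z_i] u_i, which is the minimum of the
   |Z_i|.  The default value n does not affect the minimum, as |Z_i| <= n, and
   the empty family is a decomposition only of M = 0. *)
Definition sdepth_decomposition D : nat :=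
  \big[minn/n]_(i < sf_card D) #|sf_vars i|.

(* The bound n.+1 is no restriction: [sdepth_decomposition D] <= n. *)
Definition sdepth : nat :=
  \max_(d < n.+1 | `[< exists2 D, is_stanley_decomposition D
                                & sdepth_decomposition D = d >]) d.

End StanleyDepth.

Arguments stanley_space {K n M} D i.

Section CanonicalForm.
Variables (K : fieldType) (n : nat).
Local Notation S := {mpoly K[n]}.
Implicit Types (I J L : monIdeal K n) (j : 'I_n) (ks : seq nat).

Definition power_enters j (r : nat) (m : 'X_{1..n}) : bool :=
  (U_(j) *+ r <= m)%MM && ~~ (U_(j) *+ r.+1 <= m)%MM.

Lemma power_entersE j r m : power_enters j r m = (m j == r).
Proof.
have le_U k : (U_(j) *+ k <= m)%MM = (k <= m j)%N.
  apply/mnm_lepP/idP => [/(_ j)|le_k i]; rewrite mulmnE mnm1E ?eqxx ?mul1n //.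
  by case: eqP => [<-|_]; rewrite ?mul1n ?mul0n.
by rewrite /power_enters !le_U -leqNgt eqn_leq andbC.
Qed.

Definition is_factor_type I J j ks : Prop :=
  path ltn 0 ks /\
  forall r, r \in ks <->
    (0 < r)%N /\ exists2 m, (mingens I `|` mingens J) m & power_enters j r m.

Definition factor_type I J j : seq nat := xget [::] (is_factor_type I J j).

Let nondecreasing_subseq (h : nat -> nat) :
  exists2 g : nat -> nat, {homo g : x y / (x < y)%N}
                        & {homo h \o g : x y / (x <= y)%N}.
Proof.
have /choice[p pP] N :
    exists k, (N <= k)%N /\ forall q, (N <= q)%N -> (h k <= h q)%N.
  suff main d k : (N <= k)%N -> (h k < d)%N -> exists k,
      (N <= k)%N /\ forall q, (N <= q)%N -> (h k <= h q)%N.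
    exact: main (h N).+1 N (leqnn N) (ltnSn _).
  elim: d k => // d IHd k le_Nk; rewrite ltnS => le_d.
  have [kP|] := pselect (forall q, (N <= q)%N -> (h k <= h q)%N).
    by exists k.
  move=> /existsNP[q /not_implyP[le_Nq /negP]]; rewrite -ltnNge => lt_q.
  exact: IHd q le_Nq (leq_trans lt_q le_d).
pose g := fix g k := if k is k'.+1 then p (g k').+1 else p 0%N.
have gS k : (g k < g k.+1)%N by have [] := pP (g k).+1.
have g_homo : {homo g : x y / (x < y)%N} by exact: homo_ltn ltn_trans gS.
exists g => //; apply: (homo_leq leqnn leq_trans) => k /=.
have: (g k <= g k.+1)%N by apply: ltnW.
by case: k => [|k] le_g; apply: (pP _).2 => //; apply: leq_trans le_g;
  apply: (pP _).1.
Qed.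

Let dickson (f : nat -> 'X_{1..n}) :
  exists2 g : nat -> nat, {homo g : x y / (x < y)%N}
                        & forall x y, (x <= y)%N -> (f (g x) <= f (g y))%MM.
Proof.
suff [g g_homo gP] : exists2 g : nat -> nat, {homo g : x y / (x < y)%N}
    & forall i, i \in enum 'I_n ->
      {homo (fun x => f (g x) i) : x y / (x <= y)%N}.
  exists g => // x y le_xy; apply/mnm_lepP => i.
  by apply: gP; rewrite ?mem_enum.
elim: (enum 'I_n) => [|i s [g g_homo gP]]; first by exists id.
have [h h_homo hP] := nondecreasing_subseq (fun x => f (g x) i).
exists (g \o h) => [x y lt_xy|i']; first exact/g_homo/h_homo.
rewrite inE => /orP[/eqP->|s_i'] x y le_xy; first exact: hP.
apply: gP => //; move: le_xy; rewrite leq_eqVlt => /predU1P[->//|/h_homo].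
exact: ltnW.
Qed.

Let mingens_bounded L j :
  exists N, forall m, mingens L m -> (m j <= N)%N.
Proof.
apply: contrapT => /forallNP nN.
have /choice[f fP] N : exists m, mingens L m /\ (N < m j)%N.
  have /existsNP[m /not_implyP[Lm /negP]] := nN N.
  by rewrite -ltnNge; exists m.
have [g g_homo gP] := dickson f.
have g_ge k : (k <= g k)%N.
  by elim: k => // k IHk; apply: (leq_ltn_trans IHk); apply: g_homo.
pose k := f (g 0%N) j; have [Lk lt_k] := fP (g k).
have [L0 _] := fP (g 0%N).
have /(congr1 (fun m : 'X_{1..n} => m j)) := Lk.2 _ L0.1 (gP _ _ (leq0n k)).
rewrite -/k => eq_k; move: lt_k; rewrite -eq_k ltnNge.
by rewrite (leq_trans _ (g_ge k)).
Qed.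

Lemma factor_typeP I J j : is_factor_type I J j (factor_type I J j).
Proof.
suff [ks ksP] : exists ks, is_factor_type I J j ks by exact: xgetI ksP.
have [N1 N1P] := mingens_bounded I j; have [N2 N2P] := mingens_bounded J j.
pose P r := `[< exists2 m, (mingens I `|` mingens J) m & power_enters j r m >].
exists [seq r <- iota 1 (N1 + N2) | P r]; split.
  apply: (subseq_path ltn_trans (filter_subseq _ _)).
  have iota_path d k : path ltn k (iota k.+1 d).
    by elim: d k => //= d IHd k; rewrite IHd andbT.
  exact: iota_path.
move=> r; rewrite mem_filter mem_iota; split=> [/andP[/asboolP Pr /andP[]]|] //.
move=> [r_gt0 Pr]; have -> : P r by apply/asboolP.
rewrite r_gt0 add1n ltnS /=.
case: Pr => m [/N1P|/N2P] le_m; rewrite power_entersE => /eqP <-.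
  exact: leq_trans le_m (leq_addr _ _).
exact: leq_trans le_m (leq_addl _ _).
Qed.

(* Since k_i has index i in 0 :: [:: k_1; ...; k_s], this replaces x_j^{k_i} by
   x_j^i and leaves the monomials that are not divisible by x_j unchanged. *)
Definition replace_power ks j (m : 'X_{1..n}) : 'X_{1..n} :=
  [multinom if i == j then index (m j) (0%N :: ks) else m i | i < n].

Definition replace_ideal ks j L : monIdeal K n :=
  monIdeal_gen K [set replace_power ks j m | m in mingens L].

Definition canonical_form_at j (F : monIdeal K n * monIdeal K n) :=
  let ks := factor_type F.1 F.2 j in
  (replace_ideal ks j F.1, replace_ideal ks j F.2).

(* The pair (I', J') whose factor I'/J' is the canonical form of I/J *)
Definition canonical_form I J : monIdeal K n * monIdeal K n :=
  foldl (fun F j => canonical_form_at j F) (I, J) (enum 'I_n).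

End CanonicalForm.

(* Main.v *)
(* Stanley decompositions of I/J correspond, with the same sets of free variables,
   to finite partitions of the exponent set A of I \ J into cones m + N^Z.  One
   canonical form step turns A into A' with A = f^-1(A') and A' = g^-1(A), where
   f and g act on the j-th coordinate only, by nondecreasing unbounded functions
   N -> N: f interpolates k_i |-> i and g interpolates i |-> k_i.  The preimage of
   a cone under such a map is a finite disjoint union of cones with the same Z,
   so partitions pull back along f and g without lowering min |Z|. *)
Require Import Defs.
From mathcomp Require Import all_boot all_order all_algebra.
From mathcomp Require Import generic_quotient.
From mathcomp Require Import boolp classical_sets.
From mathcomp Require Import mpoly.

Import GRing.Theory.
Local Open Scope classical_set_scope.

Set Implicit Arguments.
Unset Strict Implicit.
Unset Printing Implicit Defensive.

(* When [a] and [b] order [s] in the same way, the correspondence b r |-> a r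
   extends to a nondecreasing unbounded function: the largest [a r] with
   [b r <= t], plus a linear term beyond the last [b r]. *)
Lemma order_transfer (T : eqType) (s : seq T) (a b : T -> nat) (r0 : T) :
    r0 \in s -> a r0 = 0%N -> b r0 = 0%N ->
    {in s &, forall r r', (a r <= a r')%N = (b r <= b r')%N} ->
  exists h : nat -> nat, [/\ {homo h : x y / (x <= y)%N},
    forall c, exists t, (c <= h t)%N
    & forall t, {in s, forall r, (a r <= h t)%N = (b r <= t)%N}].
Proof.
move=> s_r0 a0 b0 ab; set N := (\max_(r <- s) b r)%N.
exists (fun t => \max_(r <- s | (b r <= t)%N) a r + (t - N))%N; split.
- move=> x y le_xy; apply: leq_add; last exact: leq_sub2r.
  apply/bigmax_leqP_seq => r s_r le_r.
  by apply: leq_bigmax_seq => //; apply: leq_trans le_xy.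
- by move=> c; exists (c + N)%N; rewrite addnK leq_addl.
move=> t r s_r; apply/idP/idP => [|le_r]; last first.
  by apply: leq_trans (leq_addr _ _); apply: leq_bigmax_seq.
apply: contraLR; rewrite -!ltnNge => lt_t.
have le_N : (b r <= N)%N by apply: leq_bigmax_seq.
have /eqP-> : (t - N == 0)%N by rewrite subn_eq0 (leq_trans (ltnW lt_t)).
rewrite addn0 ltnNge; apply/negP => le_a.
have [r' s_r' [le_r' le_ar]] :
    exists2 r', r' \in s & (b r' <= t)%N /\ (a r <= a r')%N.
  apply: contrapT => nex.
  (* Without such an [r'] every term of the maximum is below [a r]; positivity of [a r] covers the
     value 0 of an empty maximum. *)
  have r_gt0 : (0 < a r)%N.
    by rewrite ltnNge -a0 ab // b0 -ltnNge (leq_ltn_trans _ lt_t).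
  suff : (\max_(i <- s | (b i <= t)%N) a i <= (a r).-1)%N.
    by move/(leq_trans le_a); rewrite leqNgt prednK ?leqnn.
  apply/bigmax_leqP_seq => r' s_r' le_r'; rewrite -ltnS prednK // ltnNge.
  by apply/negP => le_rr'; apply: nex; exists r'.
by move: le_ar; rewrite ab // leqNgt (leq_ltn_trans le_r').
Qed.

(** * Partitions of exponent sets into cones, and their pullbacks along one coordinate *)

Section Cones.
Variable n : nat.
Implicit Types (m k : 'X_{1..n}) (Z : {set 'I_n}) (j : 'I_n).

(* The exponents of the monomials of [x^p.1 K[p.2]] *)
Definition cone (p : 'X_{1..n} * {set 'I_n}) m : bool :=
  [forall i, if i \in p.2 then (p.1 i <= m i)%N else m i == p.1 i].

(** Bridge to [retract]: the right-hand side says that [x^k] lies in [K[Z]]. *)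
Lemma coneD m Z k :
  cone (m, Z) (m + k) = [forall j, (k j != 0%N) ==> (j \in Z)].
Proof.
apply: eq_forallb => i /=; rewrite mnmDE leq_addr.
by case: (i \in Z) => /=; rewrite ?implybT // implybF negbK -{2}[m i]addn0 eqn_add2l.
Qed.

Lemma cone_le m Z k : cone (m, Z) k -> (m <= k)%MM.
Proof.
move/forallP=> mk; apply/mnm_lepP => i; have /= := mk i.
by case: ifP => // _ /eqP->.
Qed.

Lemma cone_refl p : cone p p.1.
Proof. by apply/forallP => i; case: ifP. Qed.

(** Counting with multiplicity encodes disjointness and covering in one equation, which is additive
    in [l]. *)
Definition cone_partition (A : set 'X_{1..n}) (l : seq ('X_{1..n} * {set 'I_n})) :=
  forall m, count (cone^~ m) l = `[< A m >] :> nat.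

Definition has_cone_partition (d : nat) (A : set 'X_{1..n}) :=
  exists2 l, cone_partition A l & all (fun p : _ * {set _} => (d <= #|p.2|)%N) l.

Definition set_exp j t m : 'X_{1..n} :=
  [multinom if i == j then t else m i | i < n].

Lemma set_expE j t m i : set_exp j t m i = if i == j then t else m i.
Proof. by rewrite mnmE. Qed.

(** Isolates the coordinate [j]: the second factor does not involve [t]. *)
Lemma cone_set_exp j p t m :
  cone p (set_exp j t m) =
  (if j \in p.2 then p.1 j <= t else t == p.1 j)%N
  && [forall i, (i != j) ==>
        if i \in p.2 then (p.1 i <= m i)%N else m i == p.1 i].
Proof.
apply/forallP/andP => [pm|[pj /forallP pm] i].
  split; first by have := pm j; rewrite set_expE eqxx.
  apply/forallP => i; apply/implyP => ne_ij; have := pm i.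
  by rewrite set_expE (negPf ne_ij).
rewrite set_expE; have [->|ne_ij] := eqVneq i j; first by [].
by have := pm i; rewrite ne_ij.
Qed.

Lemma cone_set_exp_base j u m Z k :
  cone (set_exp j u m, Z) k =
  (if j \in Z then u <= k j else k j == u)%N
  && [forall i, (i != j) ==>
        if i \in Z then (m i <= k i)%N else k i == m i].
Proof.
have {1}-> : k = set_exp j (k j) k.
  by apply/mnmP => i; rewrite set_expE; case: eqP => [->|].
rewrite cone_set_exp /= set_expE eqxx; congr (_ && _); apply: eq_forallb => i.
by rewrite set_expE; case: eqP.
Qed.

Section Pullback.
Variables (j : 'I_n) (h : nat -> nat).
Hypothesis h_homo : {homo h : x y / (x <= y)%N}.
Hypothesis h_unbounded : forall c, exists t, (c <= h t)%N.

(* The preimage under [h] of an infinite interval is an infinite interval, and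
   that of a point is finite, so the preimage of a cone splits into cones with
   the same free variables. *)
Lemma cone_pullback p : exists2 l,
  (forall m, count (cone^~ m) l = cone p (set_exp j (h (m j)) m) :> nat)
  & all (fun q : _ * {set _} => q.2 == p.2) l.
Proof.
case: p => k Z; have [jZ|jNZ] := boolP (j \in Z).
  (* By monotonicity the [t] with [k j <= h t] are exactly those from the least one, [t0],
     onwards. *)
  have [t0 t0P t0_min] := ex_minnP (h_unbounded (k j)).
  exists [:: (set_exp j t0 k, Z)] => [m|]; last by rewrite /= eqxx.
  rewrite /= addn0 cone_set_exp_base cone_set_exp /= jZ.
  congr (nat_of_bool (_ && _)); apply/idP/idP => [le_t|]; last exact: t0_min.
  exact: leq_trans (h_homo le_t).
(* As [h N > k j], monotonicity puts the whole fibre of [h] over [k j] below [N]. *)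
have [N NP] := h_unbounded (k j).+1.
exists [seq (set_exp j t k, Z) | t <- iota 0 N & h t == k j]; last first.
  by rewrite all_map; apply/allP => t _ /=.
move=> m; rewrite count_map cone_set_exp /= (negPf jNZ).
(* [b] is the condition on the other coordinates, common to all these cones; only the cone with
   [t = m j] can contain [m]. *)
set b := [forall i, _].
rewrite (@eq_count _ _ (fun t => (t == m j) && b)); last first.
  by move=> t /=; rewrite cone_set_exp_base (negPf jNZ) eq_sym.
case: b; last first.
  rewrite andbF; apply/eqP; rewrite -leqn0 leqNgt -has_count.
  by apply/hasPn => t _ /=; rewrite andbF.
rewrite andbT (@eq_count _ _ (pred1 (m j))); last by move=> t /=; rewrite andbT.
rewrite count_uniq_mem ?filter_uniq ?iota_uniq // mem_filter mem_iota /=.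
case: eqP => //= hm; rewrite add0n ltnNge; case: leqP => // /h_homo.
by rewrite hm leqNgt NP.
Qed.

(** Pull back the cones one by one and concatenate: the counts add up, and each new cone inherits
    its [Z], hence the bound [d]. *)
Lemma has_cone_partition_pullback d (A B : set 'X_{1..n}) :
    (forall m, A m <-> B (set_exp j (h (m j)) m)) ->
  has_cone_partition d B -> has_cone_partition d A.
Proof.
move=> AB [l lP ld].
suff [l' l'P l'd] : exists2 l',
    (forall m, count (cone^~ m) l' =
               count (cone^~ (set_exp j (h (m j)) m)) l)
    & all (fun p : _ * {set _} => (d <= #|p.2|)%N) l'.
  exists l' => // m; rewrite l'P lP; congr (nat_of_bool _).
  by apply/asboolP/asboolP => /AB.
elim: l ld {lP} => [|p l IHl] /=; first by exists [::].
move=> /andP[pd /IHl[l' l'P l'd]]; have [l0 l0P l0p] := cone_pullback p.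
exists (l0 ++ l') => [m|]; first by rewrite count_cat l0P l'P.
rewrite all_cat l'd andbT; apply/allP => q /(allP l0p)/eqP->.
exact: pd.
Qed.

End Pullback.
End Cones.

(** * Effect of the canonical form on the exponents of [I \ J] *)

Section CanonicalFormExponents.
Variables (K : fieldType) (n : nat).
Implicit Types (I J L : monIdeal K n) (m : 'X_{1..n}) (j : 'I_n).

Definition factor_exps I J : set 'X_{1..n} :=
  [set m | (I : set _) 'X_[m] /\ ~ (J : set _) 'X_[m]].

Lemma monIdealXP L m :
  (L : set _) 'X_[m] <-> exists2 g, mingens L g & (g <= m)%MM.
Proof.
by have := monomial_genX K (mingens L) m; rewrite monomial_gen_mingens.
Qed.

Lemma replace_idealXP ks j L m :
  (replace_ideal ks j L : set _) 'X_[m] <->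
  exists2 g, mingens L g & (replace_power ks j g <= m)%MM.
Proof.
rewrite /= monomial_genX; split=> [[_ [g Lg <-] le_g]|[g Lg le_g]].
  by exists g.
by exists (replace_power ks j g) => //; exists g.
Qed.

Lemma lem_set_exp j u g m :
  (g <= set_exp j u m)%MM = (g j <= u)%N && [forall i, (i != j) ==> (g i <= m i)%N].
Proof.
apply/mnm_lepP/andP => [le_gm|[le_gu /forallP le_gm] i].
  split; first by have := le_gm j; rewrite set_expE eqxx.
  apply/forallP => i; apply/implyP => ne_ij; have := le_gm i.
  by rewrite set_expE (negPf ne_ij).
by rewrite set_expE; case: eqP (le_gm i) => [->|].
Qed.

Lemma set_exp_id j m : set_exp j (m j) m = m.
Proof. by apply/mnmP => i; rewrite set_expE; case: eqP => [->|]. Qed.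

Lemma replace_power_lem_set_exp ks j u g m :
  (replace_power ks j g <= set_exp j u m)%MM =
  (index (g j) (0%N :: ks) <= u)%N && [forall i, (i != j) ==> (g i <= m i)%N].
Proof.
(* [replace_power] is an instance of [set_exp] by conversion. *)
rewrite lem_set_exp [replace_power _ _ _]/(set_exp j _ g) set_expE eqxx.
by congr (_ && _); apply: eq_forallb => i; rewrite set_expE; case: eqP.
Qed.

Section Replace.
Variables (ks : seq nat) (j : 'I_n) (L : monIdeal K n) (h : nat -> nat).

(** Divisibility by a generator splits into a condition on the [j]-th exponent, which the hypothesis
    carries through [h], and conditions on the other exponents, which the replacement leaves
    alone. *)
Lemma replace_ideal_set_exp :
    (forall g t, mingens L g ->
      (index (g j) (0%N :: ks) <= h t)%N = (g j <= t)%N) ->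
  forall m, (L : set _) 'X_[m] <->
            (replace_ideal ks j L : set _) 'X_[set_exp j (h (m j)) m].
Proof.
move=> hP m; rewrite replace_idealXP monIdealXP; split=> -[g Lg le_g]; exists g => //.
  by rewrite replace_power_lem_set_exp hP // -lem_set_exp set_exp_id.
by move: le_g; rewrite replace_power_lem_set_exp hP // -lem_set_exp set_exp_id.
Qed.

Lemma set_exp_replace_ideal :
    (forall g t, mingens L g ->
      (g j <= h t)%N = (index (g j) (0%N :: ks) <= t)%N) ->
  forall m, (replace_ideal ks j L : set _) 'X_[m] <->
            (L : set _) 'X_[set_exp j (h (m j)) m].
Proof.
move=> hP m; rewrite replace_idealXP monIdealXP; split=> -[g Lg le_g]; exists g => //.
  by rewrite lem_set_exp hP // -replace_power_lem_set_exp set_exp_id.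
by move: le_g; rewrite lem_set_exp hP // -replace_power_lem_set_exp set_exp_id.
Qed.

End Replace.

(** For [0 :: ks] this is the order compatibility of [i] and [k_i] that [order_transfer]
    requires. *)
Lemma index_sorted_leq (s : seq nat) : sorted ltn s ->
  {in s &, forall x y, (index x s <= index y s)%N = (x <= y)%N}.
Proof.
move=> s_sorted x y sx sy.
rewrite -{2}(nth_index 0%N sx) -{2}(nth_index 0%N sy).
have /= := sorted_ltn_nth ltn_trans 0%N s_sorted.
have [eq_i|lt_i|lt_i] := ltngtP (index x s) (index y s) => sP.
- by rewrite ltnW // sP // inE index_mem.
- by apply/esym/negbTE; rewrite -ltnNge sP // inE index_mem.
- by rewrite lt_i leqnn.
Qed.

Lemma has_cone_partition_canonical_form_at d j I J :
  has_cone_partition d (factor_exps I J) <->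
  has_cone_partition d (factor_exps (canonical_form_at j (I, J)).1
                                    (canonical_form_at j (I, J)).2).
Proof.
rewrite /canonical_form_at /=; set ks := factor_type I J j.
have [ks_path ksP] : is_factor_type I J j ks := factor_typeP I J j.
pose s := 0%N :: ks.
(* The [j]-th exponent of a generator is 0 or, by definition of the type, one of the [k_i]. *)
have s_gen g : (mingens I `|` mingens J) g -> g j \in s.
  move=> IJg; rewrite inE; case: posnP => //= gj_gt0; apply/ksP.
  by split=> //; exists g => //; rewrite power_entersE.
have s_index := @index_sorted_leq s ks_path.
have s0 : 0%N \in s by rewrite inE.
have i0 : index 0%N s = 0%N by [].
split.
  (* This [h] interpolates [i |-> k_i] and pulls a partition for [I/J] back to the canonical
     form. *)
  have [h [h_homo h_unb hP]] := order_transfer (a := id) s0 (erefl 0%N) i0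
    (fun x y sx sy => esym (s_index x y sx sy)).
  apply: (has_cone_partition_pullback h_homo h_unb) => m.
  have IJh L : mingens L `<=` mingens I `|` mingens J ->
      (replace_ideal ks j L : set _) 'X_[m] <->
      (L : set _) 'X_[set_exp j (h (m j)) m].
    by move=> LIJ; apply: set_exp_replace_ideal => g t /LIJ/s_gen/hP.
  have := IJh I (@subsetUl _ _ _); have := IJh J (@subsetUr _ _ _).
  by move=> [J1 J2] [I1 I2]; split=> -[Im Jm]; split; auto.
(* With the roles exchanged, [h] interpolates [k_i |-> i]. *)
have [h [h_homo h_unb hP]] := order_transfer (b := id) s0 i0 (erefl 0%N) s_index.
apply: (has_cone_partition_pullback h_homo h_unb) => m.
have IJh L : mingens L `<=` mingens I `|` mingens J ->
    (L : set _) 'X_[m] <->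
    (replace_ideal ks j L : set _) 'X_[set_exp j (h (m j)) m].
  by move=> LIJ; apply: replace_ideal_set_exp => g t /LIJ/s_gen/hP.
have := IJh I (@subsetUl _ _ _); have := IJh J (@subsetUr _ _ _).
by move=> [J1 J2] [I1 I2]; split=> -[Im Jm]; split; auto.
Qed.

Lemma has_cone_partition_canonical_form d I J :
  has_cone_partition d (factor_exps I J) <->
  has_cone_partition d (factor_exps (canonical_form I J).1
                                    (canonical_form I J).2).
Proof.
(* The pair is generalized because each step computes the type of the pair left by the previous
   ones. *)
rewrite /canonical_form; elim: (enum 'I_n) I J => [|j s IHs] I J //=.
by rewrite (has_cone_partition_canonical_form_at d j) IHs.
Qed.

End CanonicalFormExponents.

(** * Coordinates on [I/J] with respect to monomial classes *)

Section FactorCoefficients.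
Variables (K : fieldType) (n : nat) (I J : monIdeal K n).
Local Notation S := {mpoly K[n]}.
Local Notation M := (factor I J).
Implicit Types (v w : M) (m k : 'X_{1..n}) (f : S).
Local Open Scope ring_scope.
Local Open Scope quotient_scope.

Lemma monIdeal_msupp (L : monIdeal K n) (p : S) :
  (L : set S) p <-> forall m, m \in msupp p -> (L : set S) 'X_[m].
Proof.
rewrite -{1}(monomial_gen_mingens L) monomial_genP.
by split=> Lp m /Lp; rewrite monIdealXP.
Qed.

Lemma monIdealX_lem (L : monIdeal K n) m k :
  (m <= k)%MM -> (L : set S) 'X_[m] -> (L : set S) 'X_[k].
Proof.
move=> le_mk; rewrite !monIdealXP => -[g Lg le_g].
by exists g => //; apply: lepm_trans le_mk.
Qed.

(* The K-linear coordinates of I/J on the basis of the classes of the monomials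
   in I \ J *)
Definition fcoef v m : K :=
  if `[< (J : set S) 'X_[m] >] then 0 else (\val (repr v) : S)@_m.

(** Representatives differ by an element of [J], all of whose monomials lie in [J], so coefficients
    at monomials outside [J] are independent of the choice. *)
Lemma fcoef_pi (p : ideal_mod I) m :
  fcoef (\pi_M p) m = if `[< (J : set S) 'X_[m] >] then 0 else (\val p : S)@_m.
Proof.
rewrite /fcoef; case: asboolP => // NJm.
have : \pi_M (repr (\pi_M p)) = \pi_M p by rewrite reprK.
move/factor_pi_eq; set q := repr _ => /monIdeal_msupp Jpq.
apply/eqP; rewrite -subr_eq0 -mcoeffB; apply/eqP.
by apply: memN_msupp_eq0; apply/negP => /Jpq.
Qed.

Lemma fcoef_out v m : ~ factor_exps I J m -> fcoef v m = 0.
Proof.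
move=> Nm; rewrite /fcoef; case: asboolP => // NJm.
apply: memN_msupp_eq0; apply/negP => vm; apply: Nm; split=> //.
have /monIdeal_msupp : (I : set S) (\val (repr v)) by have := valP (repr v); rewrite inE.
exact.
Qed.

Lemma val_ideal_modZ f (p : ideal_mod I) : \val (f *: p) = f * (\val p : S).
Proof. by rewrite linearZ. Qed.

Lemma fcoefZ f v m :
  fcoef (f *: v) m =
  if `[< (J : set S) 'X_[m] >] then 0 else (f * (\val (repr v) : S))@_m.
Proof. by rewrite -{1}[v]reprK factor_pi_scale fcoef_pi. Qed.

Lemma factor_pi_add (p q : ideal_mod I) : \pi_M p + \pi_M q = \pi_M (p + q).
Proof.
exact/esym/(@Quotient.pi_add _ (submod_pred (sub_ideal I J)) p q).
Qed.

Lemma fcoefD v w m : fcoef (v + w) m = fcoef v m + fcoef w m.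
Proof.
have -> : v + w = \pi_M (repr v + repr w).
  by rewrite -factor_pi_add !reprK.
by rewrite fcoef_pi /fcoef; case: asboolP => _; rewrite ?addr0 ?mcoeffD.
Qed.

Lemma fcoef0 m : fcoef 0 m = 0.
Proof. by apply: (addrI (fcoef 0 m)); rewrite -fcoefD !addr0. Qed.

Lemma fcoef_sum (T : Type) (r : seq T) (P : pred T) (F : T -> M) m :
  fcoef (\sum_(i <- r | P i) F i) m = \sum_(i <- r | P i) fcoef (F i) m.
Proof.
by apply: (big_morph (fcoef^~ m)) => [v w|]; [apply: fcoefD|apply: fcoef0].
Qed.

Lemma fcoef_inj v w : (forall m, fcoef v m = fcoef w m) -> v = w.
Proof.
move=> vw; rewrite -[v]reprK -[w]reprK; apply/factor_pi_eq/monIdeal_msupp => m.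
rewrite mcoeff_msupp mcoeffB subr_eq0 => /eqP ne; apply: contrapT => NJm.
by apply: ne; have := vw m; rewrite /fcoef asboolF.
Qed.

(** The class of [x^m]; [insubd] gives the class of 0 when [x^m] is not in [I]. *)
Definition fmon m : M := \pi_M (insubd (0 : ideal_mod I) ('X_[m] : S^o)).

Lemma val_fmon m : (I : set S) 'X_[m] ->
  \val (insubd (0 : ideal_mod I) ('X_[m] : S^o)) = 'X_[m].
Proof. by move=> Im; rewrite insubdK // /monIdeal_pred inE. Qed.

Lemma fmonE m p : (I : set S) 'X_[m] -> \val p = 'X_[m] -> fmon m = \pi_M p.
Proof. by move=> Im pE; congr \pi_M; apply: val_inj; rewrite val_fmon. Qed.

Lemma fcoef_fmon m k : factor_exps I J m -> fcoef (fmon m) k = (m == k)%:R.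
Proof.
move=> [Im NJm]; rewrite fcoef_pi val_fmon // mcoeffX.
by case: asboolP => //; case: eqP => // <-.
Qed.

Lemma fmonZX k m : (I : set S) 'X_[m] -> 'X_[k] *: fmon m = fmon (k + m).
Proof.
move=> Im; rewrite factor_pi_scale; apply/esym/fmonE.
  by apply: monIdealX_lem Im; apply: lem_addl.
by rewrite val_ideal_modZ val_fmon // mpolyXD.
Qed.

Lemma fcoefZ_fmon f m k : factor_exps I J m -> ~ (J : set S) 'X_[k + m] ->
  fcoef (f *: fmon m) (k + m) = f@_k.
Proof.
move=> [Im NJm] NJk; rewrite factor_pi_scale fcoef_pi asboolF //.
by rewrite val_ideal_modZ val_fmon // addmC mcoeffMX.
Qed.

Lemma fcoefCZ (c : K) v m : fcoef (c%:MP *: v) m = c * fcoef v m.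
Proof.
by rewrite fcoefZ /fcoef; case: asboolP => _; rewrite ?mulr0 // mul_mpolyC mcoeffZ.
Qed.

End FactorCoefficients.

(** * Stanley decompositions versus cone partitions *)

Section StanleyDecompositions.
Variables (K : fieldType) (n : nat) (I J : monIdeal K n).
Local Notation S := {mpoly K[n]}.
Local Notation M := (factor I J).
Implicit Types (v w : M) (m k : 'X_{1..n}) (f : S) (Z : {set 'I_n}).
Implicit Types (D : stanley_family M).
Local Open Scope ring_scope.
Local Open Scope quotient_scope.
Local Notation fmon := (fmon I J).

(** A degree determines at most one monomial, so each graded component has dimension at most one
    over [K]. *)
Lemma factor_degree_fmon a v : factor_degree I J a v -> v != 0 ->
  exists m (c : K), [/\ factor_exps I J m, c != 0 & v = c%:MP *: fmon m].
Proof.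
move=> [p /= pa <-]; set u := \pi_M p => u_neq0.
have [k uk] : exists k, fcoef u k != 0.
  apply: contrapT => Nv; case/eqP: u_neq0; apply: fcoef_inj => k.
  by rewrite fcoef0; apply/eqP; apply: contrapT => /negP uk; apply: Nv; exists k.
have Ak : factor_exps I J k by apply: contrapT => Nk; move: uk; rewrite fcoef_out ?eqxx.
exists k, (fcoef u k); split=> //; apply: fcoef_inj => m.
rewrite fcoefCZ fcoef_fmon //; have [->|ne_km] := eqVneq k m; first by rewrite mulr1.
rewrite mulr0 fcoef_pi; case: asboolP => // _.
apply: memN_msupp_eq0; apply: contra ne_km => pm; apply/eqP/mnmP => i.
suff : (k i)%:Z = m i by case.
rewrite (pa m pm) (pa k) // mcoeff_msupp; apply: contra uk => /eqP pk.
by rewrite fcoef_pi pk if_same.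
Qed.

Lemma fmon_degree m : factor_exps I J m ->
  factor_degree I J [ffun i => (m i)%:Z] (fmon m).
Proof.
move=> [Im _]; exists (insubd (0 : ideal_mod I) ('X_[m] : S^o)) => //= k.
by rewrite val_fmon // msuppX mem_seq1 => /eqP-> i; rewrite ffunE.
Qed.

Lemma retractX Z k : retract Z ('X_[K, k]) <-> forall j, k j != 0%N -> j \in Z.
Proof.
split=> [kZ|kZ m]; first by apply: kZ; rewrite msuppX mem_head.
by rewrite msuppX mem_seq1 => /eqP->.
Qed.

Lemma retract_cone Z m k f : retract Z f -> k \in msupp f -> cone (m, Z) (m + k)%MM.
Proof.
by move=> fZ fk; rewrite coneD; apply/forallP => j; apply/implyP; apply: fZ.
Qed.

Lemma fcoef_retract m Z f k : factor_exps I J m -> retract Z f ->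
  fcoef (f *: fmon m) k != 0 -> cone (m, Z) k.
Proof.
move=> [Im _] fZ; rewrite factor_pi_scale fcoef_pi val_ideal_modZ val_fmon //.
case: asboolP => [_|_]; first by rewrite eqxx.
rewrite -mcoeff_msupp (perm_mem (msuppMX _ _)) => /mapP[t ft ->].
exact: retract_cone ft.
Qed.

Lemma cone_retract m Z k : (I : set S) 'X_[m] -> cone (m, Z) k ->
  retract Z ('X_[K, k - m]) /\ 'X_[k - m] *: fmon m = fmon k.
Proof.
move=> Im mk; have le_mk := cone_le mk; split.
  move: mk; rewrite -(submK le_mk) addmC coneD => /forallP mk.
  by apply/retractX => j; apply/implyP; rewrite addmC addmK.
by rewrite fmonZX // submK.
Qed.

Lemma retractC Z f (c : K) : retract Z f -> retract Z (c%:MP * f).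
Proof. by move=> fZ m; rewrite mul_mpolyC => /msuppZ_le; apply: fZ. Qed.

Lemma retract0 Z : retract Z (0 : S).
Proof. by move=> m; rewrite msupp0. Qed.

(** The bound [d <= n] accounts for the default value [n] of the minimum. *)
Lemma leq_sdepth_decomposition D d : (d <= n)%N ->
  (d <= sdepth_decomposition D)%N = [forall i, d <= #|sf_vars (s := D) i|]%N.
Proof.
move=> le_dn; rewrite /sdepth_decomposition.
rewrite (big_morph (leq d) (id1 := true) (op1 := andb)) ?big_andE // => x y.
by rewrite leq_min.
Qed.

Lemma sdepth_decomposition_leq D : (sdepth_decomposition D <= n)%N.
Proof.
apply: (big_ind (fun x => x <= n)%N) => // [x y le_xn _|i _].
  by rewrite geq_min le_xn.
by rewrite -[n in (_ <= n)%N]card_ord max_card.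
Qed.

(** Freeness keeps the cones inside the exponent set, uniqueness of the sum makes them disjoint, and
    its existence makes them cover. *)
Lemma stanley_cone_partition D :
  is_stanley_decomposition (factor_degree I J) D ->
  has_cone_partition (sdepth_decomposition D) (factor_exps I J).
Proof.
move=> [D_homog D_free D_sum].
have /choice[mc mcP] : forall i : 'I_(sf_card D), exists mc : 'X_{1..n} * K,
    [/\ factor_exps I J mc.1, mc.2 != 0 & sf_elem i = mc.2%:MP *: fmon mc.1].
  move=> i; have [a /factor_degree_fmon] := D_homog i.
  case=> [|m [c mc]]; last by exists (m, c).
  (* A zero [u_i] would be annihilated by 1, which lies in every [K[Z]]. *)
  apply/eqP => Di; have : (1 : S) = 0.
    apply: (D_free i); last by rewrite Di scaler0.
    by rewrite -mpolyX0; apply/retractX => j; rewrite mnm0E.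
  by apply/eqP; rewrite oner_eq0.
pose b i := ((mc i).1, sf_vars (s := D) i).
have b_in i k : cone (b i) k -> factor_exps I J k.
  move=> bk; have [[Im NJm] c_neq0 Di] := mcP i.
  have [kZ kE] := cone_retract Im bk.
  split; first by apply: monIdealX_lem Im; apply: cone_le bk.
  (* If [x^k] were in [J], the monomial [x^(k - m_i)] of [K[Z_i]] would annihilate [u_i]. *)
  move=> Jk; have : ('X_[K, k - (mc i).1] : S) = 0.
    apply: (D_free i) => //; rewrite Di scalerA mulrC -scalerA kE.
    apply: fcoef_inj => t; rewrite fcoef0 fcoefCZ fcoef_pi.
    rewrite val_fmon; last by apply: monIdealX_lem Im; apply: cone_le bk.
    case: asboolP => [|NJt]; rewrite ?mulr0 // mcoeffX.
    by case: eqP NJt => [<- //|_]; rewrite mulr0.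
  by apply/eqP; rewrite -msupp_eq0 msuppX.
have b_space i k : cone (b i) k -> stanley_space D i (fmon k).
  move=> bk; have [[Im _] c_neq0 Di] := mcP i.
  have [kZ kE] := cone_retract Im bk.
  exists ((mc i).2^-1%:MP * 'X_[k - (mc i).1]); first exact: retractC.
  by rewrite Di scalerA mulrAC -mpolyCM mulVf // mpolyC1 mul1r kE.
have space_b i w k : stanley_space D i w -> fcoef w k != 0 -> cone (b i) k.
  move=> [f fZ <-]; have [Am _ ->] := mcP i.
  rewrite scalerA mulrC -scalerA fcoefCZ mulf_eq0 negb_or => /andP[_].
  exact: fcoef_retract.
exists [seq b i | i : 'I_(sf_card D)]; last first.
  rewrite all_map; apply/allP => i _ /=.
  by apply/forallP: i; rewrite -leq_sdepth_decomposition ?sdepth_decomposition_leq.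
move=> k; rewrite count_map -sum1_count big_enum_cond sum1dep_card /=.
case: asboolP => [Ak|NAk]; last by apply: eq_card0 => i; rewrite inE; apply/negP => /b_in.
have [w [[wP wE] w_unique]] := D_sum (fmon k).
apply/eqP; rewrite eqn_leq; apply/andP; split.
  apply/card_le1_eqP => i1 i2; rewrite !inE => bi1 bi2.
  (* Each cone containing [k] yields a decomposition of [fmon k] with a single nonzero term;
     uniqueness identifies them. *)
  pose delta i : {ffun 'I_(sf_card D) -> M} :=
    [ffun i' => if i' == i then fmon k else 0].
  have deltaP i : cone (b i) k -> delta i = w.
    move=> bi; apply/esym/w_unique; split=> [i'|].
      rewrite ffunE; case: eqP => [->|_]; first exact: b_space.
      by exists 0; [apply: retract0|rewrite scale0r].
    by under eq_bigr do rewrite ffunE; rewrite -big_mkcond big_pred1_eq.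
  apply/eqP; apply: contraT => ne_i.
  have := congr1 (fun w : {ffun _} => fcoef (w i1) k) (deltaP i1 bi1).
  rewrite -(deltaP i2 bi2) !ffunE eqxx eq_sym (negPf ne_i) fcoef0 fcoef_fmon // eqxx.
  by move/eqP; rewrite oner_eq0.
(* If no cone contained [k], every summand of [fmon k] would have coordinate 0 at [k], while the sum
   has 1. *)
apply/card_gt0P; apply: contrapT => Nk.
have := congr1 (fun v => fcoef v k) wE.
rewrite fcoef_fmon // eqxx fcoef_sum big1 => [/eqP|i _]; first by rewrite oner_eq0.
by apply/eqP; apply: contraT => /(space_b _ _ _ (wP i)) bi; case: Nk; exists i; rewrite inE.
Qed.

Lemma cone_partition_stanley d : (d <= n)%N ->
    has_cone_partition d (factor_exps I J) ->
  exists2 D, is_stanley_decomposition (factor_degree I J) D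
           & (d <= sdepth_decomposition D)%N.
Proof.
move=> le_dn [l lA ld].
pose b (i : 'I_(size l)) := tnth (in_tuple l) i.
pose D := @StanleyFamily K n M (size l) (fun i => (b i).2) (fun i => fmon (b i).1).
have b_card k : #|[pred i | cone (b i) k]| = `[< factor_exps I J k >].
  by rewrite -lA -sum1_count (big_tnth _ _ l) -sum1_card; apply: eq_bigl.
have b_in i k : cone (b i) k -> factor_exps I J k.
  move=> bk; apply/asboolP; rewrite -[`[< _ >]]lt0b -b_card.
  by apply/card_gt0P; exists i.
have b_uniq i1 i2 k : cone (b i1) k -> cone (b i2) k -> i1 = i2.
  move=> bi1 bi2; have /card_le1_eqP : (#|[pred i | cone (b i) k]| <= 1)%N.
    by rewrite b_card leq_b1.
  by apply.
have b_exps i : factor_exps I J (b i).1 := b_in i _ (cone_refl _).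
have space_b i w k : stanley_space D i w -> fcoef w k != 0 -> cone (b i) k.
  move=> [f fZ <-] fk; rewrite [b i]surjective_pairing.
  exact: fcoef_retract fZ fk.
exists D; last first.
  rewrite leq_sdepth_decomposition //; apply/forallP => i.
  by have /allP/(_ _ (mem_tnth i (in_tuple l))) := ld.
split=> [i|i f fZ f0|v].
- by eexists; apply: fmon_degree.
(* Multiplication by [f] carries its coefficient at [k] to a point of the cone, which lies outside
   [J], so nothing is lost in the quotient. *)
- apply/eqP; rewrite -msupp_eq0; apply: contraT.
  case fs: (msupp f) => [//|k s] _.
  have fk : k \in msupp f by rewrite fs mem_head.
  have := retract_cone (b i).1 fZ fk; rewrite -surjective_pairing addmC => /b_in[_ NJ].
  move: fk; rewrite mcoeff_msupp -(fcoefZ_fmon f (b_exps i) NJ) f0.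
  by rewrite fcoef0 eqxx.
pose p : S := \val (repr v).
(* [w i] is the part of [v] supported on the cone [b i]; monomials of [p] in [J] lie in no cone and
   drop out. *)
pose w : {ffun 'I_(size l) -> M} :=
  [ffun i => \sum_(k <- msupp p | cone (b i) k) (p@_k)%:MP *: fmon k].
have wE i k : fcoef (w i) k = if cone (b i) k then fcoef v k else 0.
  rewrite ffunE fcoef_sum.
  rewrite (eq_bigr (fun k' => (k' == k)%:R * fcoef v k)) => [|k' bk']; last first.
    rewrite fcoefCZ fcoef_fmon; last exact: b_in bk'.
    case: eqP => [<-|_]; last by rewrite mulr0 mul0r.
    rewrite mulr1 mul1r /fcoef asboolF //.
    by case: (b_in _ _ bk').
  rewrite -mulr_suml big_mkcond /=.
  have [pk|pk] := boolP (k \in msupp p); last first.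
    by rewrite /fcoef -/p (memN_msupp_eq0 pk) !if_same mulr0.
  rewrite (bigD1_seq k) //= eqxx big1 => [|k' /negPf->]; last by rewrite if_same.
  by case: ifP; rewrite addr0 ?mul1r ?mul0r.
have wb i k : fcoef (w i) k != 0 -> cone (b i) k.
  by rewrite wE; case: ifP => //; rewrite eqxx.
exists w; split; [split=> [i|]|move=> w' [w'P vE]].
- have -> : w i = \sum_(k <- msupp p | cone (b i) k)
                    ((p@_k)%:MP * 'X_[k - (b i).1]) *: fmon (b i).1.
    rewrite ffunE; apply: eq_bigr => k; rewrite {1}[b i]surjective_pairing => bk.
    by have [_ <-] := cone_retract (b_exps i).1 bk; rewrite scalerA.
  rewrite -scaler_suml; eexists; last by [].
  move=> m /msupp_sum_le/flatten_mapP[k]; rewrite mem_filter => /andP[bk _].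
  rewrite [b i]surjective_pairing in bk.
  by apply/retractC/(cone_retract (b_exps i).1 bk).1.
- apply: fcoef_inj => k; rewrite fcoef_sum.
  under eq_bigr do rewrite wE.
  rewrite -big_mkcond sumr_const b_card; case: asboolP => //= NAk.
  by rewrite fcoef_out.
(* At [k] in the cone [b i] all other [w' i'] vanish by disjointness; off this cone [w' i] itself
   vanishes. *)
apply/ffunP => i; apply: fcoef_inj => k; rewrite wE vE fcoef_sum.
case: ifP => bk; last first.
  by apply/esym/eqP; apply: contraFT bk; apply: space_b.
rewrite (bigD1 i) //= big1 ?addr0 // => i' ne_i'; apply/eqP.
by apply: contraT => /(space_b _ _ _ (w'P i')) bk'; rewrite (b_uniq _ _ _ bk' bk) eqxx in ne_i'.
Qed.

Lemma sdepthE : sdepth (factor_degree I J) =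
  \max_(d < n.+1 | `[< has_cone_partition d (factor_exps I J) >]) d.
Proof.
apply/eqP; rewrite eqn_leq; apply/andP; split; apply/bigmax_leqP => d /asboolP.
  move=> [D DP Dd]; apply: (leq_bigmax_cond (F := @nat_of_ord _)).
  by apply/asboolP; rewrite -Dd; apply: stanley_cone_partition.
move=> /cone_partition_stanley[|D DP le_d]; first by rewrite -ltnS.
(* The depth of [D] may exceed [d], so [D] enters the maximum through its own depth. *)
apply: leq_trans le_d _.
have le_D : (sdepth_decomposition D < n.+1)%N by apply: sdepth_decomposition_leq.
apply: (leq_bigmax_cond (F := @nat_of_ord _) (Ordinal le_D)).
by apply/asboolP; exists D.
Qed.

End StanleyDecompositions.

Theorem theorem1 (K : fieldType) (n : nat) (I J : monIdeal K n)
    (ltJI : monIdeal_set J `<` monIdeal_set I) :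
  sdepth (factor_degree I J) =
  sdepth (factor_degree (canonical_form I J).1 (canonical_form I J).2).
Proof.
rewrite !sdepthE; apply: eq_bigl => d.
by apply: asbool_equiv_eq; apply: has_cone_partition_canonical_form.
Qed.
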